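(* Let $a$, $z$ and $q$ be complex numbers with $|z|<1$ and $|q|<1$. Then $$\sum_{n=0}^{\infty}\frac{(a;q)_n z^n}{(q;q)_n}=\frac{(az;q)_{\infty}}{(z;q)_{\infty}}.$$
   Context: Notation: $(x;q)_0=1$, $(x;q)_n=\prod_{j=0}^{n-1}(1-xq^{j})$ for $n\ge 1$, and $(x;q)_\infty=\prod_{j=0}^{\infty}(1-xq^{j})$, with the convention $x^0=1$ for all $x$. *)

(* Defs.v *)
(* Stdlib reals with Coquelicot: complex numbers are Coquelicot's [C]. *)
From Stdlib Require Import Reals.
From Coquelicot Require Export Coquelicot.

Local Open Scope C_scope.

(* (x;q)_n.  [Cpow] satisfies x ^ 0 = 1 for every x, including x = 0. *)
Fixpoint qpoch (x q : C) (n : nat) : C :=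
  match n with
  | O => 1
  | S m => qpoch x q m * (1 - x * q ^ m)
  end.

(* (x;q)_oo as the limit of the partial products.  [lim] is total, so this is
   meaningful only together with [qpoch_inf_cvg x q]. *)
Definition qpoch_inf (x q : C) : C :=
  @lim C_CompleteNormedModule (filtermap (qpoch x q) eventually).

Definition qpoch_inf_cvg (x q : C) : Prop :=
  filterlim (qpoch x q) eventually (@locally C_UniformSpace (qpoch_inf x q)).

(* Main.v *)
Require Import Defs.
From Stdlib Require Import Reals.
From Stdlib Require Import Lra Lia.
From Coquelicot Require Import Coquelicot.
Local Open Scope C_scope.

(** Let [F w] be the sum of the series at [w].  The recurrence of the
    coefficients gives [(1 - w) F(w) = (1 - a w) F(q w)], so
    [(z;q)_n F(z) = (az;q)_n F(z q^n)], and [F(z q^n)] tends to [F(0) = 1].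
    For [a = 0] the right-hand side is just [F(z q^n)]: hence [F(z)] is then
    nonzero and [(z;q)_n] converges to [1 / F(z)], which settles convergence
    and nonvanishing of [(z;q)_oo] without any theory of infinite products. *)

(** * Limits and series of complex numbers *)

Lemma filterlim_C_Cmod (u : nat -> C) (l : C) :
  filterlim u eventually (@locally C_UniformSpace l) <->
  is_lim_seq (fun n => Cmod (u n - l)) 0%R.
Proof.
  rewrite (@filterlim_locally_ball_norm C_AbsRing nat C_NormedModule)
    by apply eventually_filter.
  rewrite <- is_lim_seq_spec.
  split; intros H eps; generalize (H eps); apply filter_imp; intros n Hn.
  - rewrite Rminus_0_r, Rabs_pos_eq by apply Cmod_ge_0. exact Hn.
  - rewrite Rminus_0_r, Rabs_pos_eq in Hn by apply Cmod_ge_0. exact Hn.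
Qed.

(** Continuity of multiplication is available for the uniform structure that [C] gets from [Cmod];
    [locally_C] identifies its neighbourhoods with those of [C_UniformSpace]. *)
Lemma filterlim_C_mult (u v : nat -> C) (l m : C) :
  filterlim u eventually (@locally C_UniformSpace l) ->
  filterlim v eventually (@locally C_UniformSpace m) ->
  filterlim (fun n => u n * v n) eventually (@locally C_UniformSpace (l * m)).
Proof.
  intros Hu Hv P HP.
  apply locally_C in HP.
  refine (filterlim_comp_2 u v (@mult C_AbsRing) _ _
            (@filterlim_mult C_AbsRing l m) P HP).
  - intros Q HQ. apply Hu. apply locally_C. exact HQ.
  - intros Q HQ. apply Hv. apply locally_C. exact HQ.
Qed.

Lemma filterlim_C_unique (u : nat -> C) (l m : C) :
  filterlim u eventually (@locally C_UniformSpace l) ->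
  filterlim u eventually (@locally C_UniformSpace m) -> l = m.
Proof.
  exact (@filterlim_locally_unique nat C_AbsRing C_NormedModule eventually _ u l m).
Qed.

(** The total operator [lim] is specified only on Cauchy filters. A convergent sequence yields one,
    and uniqueness of limits does the rest. *)
Lemma lim_C_eq (u : nat -> C) (l : C) :
  filterlim u eventually (@locally C_UniformSpace l) ->
  @lim C_CompleteNormedModule (filtermap u eventually) = l.
Proof.
  intros H.
  apply (filterlim_C_unique u); [|exact H].
  apply (proj2 (@filterlim_locally nat C_CompleteNormedModule eventually _ u _)).
  intros eps.
  apply (@complete_cauchy C_CompleteNormedModule (filtermap u eventually)).
  - apply filtermap_proper_filter, eventually_filter.
  - intros e. exists l. apply H. apply locally_ball.
Qed.

Lemma qpoch_inf_eq (x q l : C) :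
  filterlim (qpoch x q) eventually (@locally C_UniformSpace l) ->
  qpoch_inf_cvg x q /\ qpoch_inf x q = l.
Proof.
  intros H. unfold qpoch_inf_cvg.
  assert (E : qpoch_inf x q = l) by exact (lim_C_eq _ _ H).
  rewrite E. split; [exact H | reflexivity].
Qed.

Lemma is_series_C_ext (u v : nat -> C) (l : C) :
  (forall n, u n = v n) ->
  @is_series C_AbsRing C_NormedModule u l ->
  @is_series C_AbsRing C_NormedModule v l.
Proof. exact (@is_series_ext C_AbsRing C_NormedModule u v l). Qed.

Lemma is_series_C_Cmod_le (u : nat -> C) (v : nat -> R) (l : C) (m : R) :
  (forall n, (Cmod (u n) <= v n)%R) ->
  @is_series C_AbsRing C_NormedModule u l -> is_series v m -> (Cmod l <= m)%R.
Proof.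
  intros Huv Hu Hv.
  apply (is_lim_seq_le (fun n => Cmod (@sum_n C_NormedModule u n)) (sum_n v)
           (Cmod l) m).
  - intros n.
    eapply Rle_trans.
    + exact (@norm_sum_n_m C_AbsRing C_NormedModule u 0 n).
    + apply sum_n_m_le. exact Huv.
  - exact (filterlim_comp _ _ _ _ _ _ _ _ Hu
             (@filterlim_norm C_AbsRing C_NormedModule l)).
  - exact Hv.
Qed.

(** * Finite products *)

Lemma qpoch_add (x q : C) (m n : nat) :
  qpoch x q (m + n) = qpoch x q m * qpoch (x * q ^ m) q n.
Proof.
  induction n as [|n IH].
  - rewrite Nat.add_0_r. simpl. ring.
  - rewrite Nat.add_succ_r. simpl. rewrite IH, Cpow_add_r. ring.
Qed.

Lemma qpoch_0_l (q : C) (n : nat) : qpoch 0 q n = 1.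
Proof. induction n as [|n IH]; simpl; [|rewrite IH]; ring. Qed.

Lemma pow_S_lt_1 (r : R) (n : nat) : (0 <= r < 1 -> 0 <= r ^ S n < 1)%R.
Proof.
  intros Hr. split.
  - apply pow_le, Hr.
  - apply pow_lt_1_compat; [exact Hr | lia].
Qed.

Lemma Cminus_1_neq_0 (x : C) : (Cmod x < 1)%R -> 1 - x <> 0.
Proof.
  intros Hx E.
  replace x with (1 - (1 - x)) in Hx by ring.
  rewrite E in Hx. replace (1 - 0) with (RtoC 1) in Hx by ring.
  rewrite Cmod_1 in Hx. lra.
Qed.

(** * Coefficients of the series and a majorant *)

Section qbinomial.

Variables a q : C.
Hypothesis hq : (Cmod q < 1)%R.

Lemma Cmod_q_bounds : (0 <= Cmod q < 1)%R.
Proof. split; [apply Cmod_ge_0 | exact hq]. Qed.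

Lemma one_minus_qpow_neq_0 (n : nat) : 1 - q ^ S n <> 0.
Proof.
  apply Cminus_1_neq_0. rewrite Cmod_pow. apply pow_S_lt_1, Cmod_q_bounds.
Qed.

Lemma qpoch_q_neq_0 (n : nat) : qpoch q q n <> 0.
Proof.
  induction n as [|n IH].
  - exact C1_nz.
  - simpl. apply Cmult_neq_0; [exact IH|].
    rewrite <- Cpow_S. apply one_minus_qpow_neq_0.
Qed.

Definition qbin (n : nat) : C := qpoch a q n / qpoch q q n.

Lemma qbin_S (n : nat) :
  qbin (S n) = qbin n * ((1 - a * q ^ n) / (1 - q ^ S n)).
Proof.
  unfold qbin. rewrite Cpow_S. simpl. field.
  split; [rewrite <- Cpow_S; apply one_minus_qpow_neq_0 | apply qpoch_q_neq_0].
Qed.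

(** A majorant of [Cmod (qbin n)], obtained by applying the triangle inequality to each factor of
    the recurrence. It stays positive, as the ratio test requires, whereas [qbin] vanishes from some
    index on when [a * q ^ k = 1] for some [k]. *)
Fixpoint qbin_bound (n : nat) : R :=
  match n with
  | O => 1
  | S m => qbin_bound m * ((1 + Cmod a * Cmod q ^ m) / (1 - Cmod q ^ S m))
  end%R.

Lemma qbin_bound_ratio_pos (n : nat) :
  (0 < (1 + Cmod a * Cmod q ^ n) / (1 - Cmod q ^ S n))%R.
Proof.
  apply Rdiv_lt_0_compat.
  - apply Rplus_lt_le_0_compat; [lra|].
    apply Rmult_le_pos; [apply Cmod_ge_0 | apply pow_le, Cmod_ge_0].
  - apply Rlt_0_minus, pow_S_lt_1, Cmod_q_bounds.
Qed.

Lemma qbin_bound_pos (n : nat) : (0 < qbin_bound n)%R.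
Proof.
  induction n as [|n IH]; [simpl; lra|].
  apply Rmult_lt_0_compat; [exact IH | apply qbin_bound_ratio_pos].
Qed.

Lemma qbin_le_bound (n : nat) : (Cmod (qbin n) <= qbin_bound n)%R.
Proof.
  induction n as [|n IH].
  - unfold qbin, Cdiv. simpl. rewrite Cinv_r by exact C1_nz. rewrite Cmod_1. lra.
  - rewrite qbin_S, Cmod_mult, Cmod_div by apply one_minus_qpow_neq_0.
    change (qbin_bound (S n)) with
      (qbin_bound n * ((1 + Cmod a * Cmod q ^ n) / (1 - Cmod q ^ S n)))%R.
    assert (Hd : (0 < 1 - Cmod q ^ S n)%R)
      by apply Rlt_0_minus, pow_S_lt_1, Cmod_q_bounds.
    apply Rmult_le_compat; [apply Cmod_ge_0 | | exact IH |].
    + apply Rmult_le_pos; [apply Cmod_ge_0|].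
      apply Rlt_le, Rinv_0_lt_compat, Cmod_gt_0, one_minus_qpow_neq_0.
    + apply Rmult_le_compat.
      * apply Cmod_ge_0.
      * apply Rlt_le, Rinv_0_lt_compat, Cmod_gt_0, one_minus_qpow_neq_0.
      * eapply Rle_trans; [apply Cmod_triangle|].
        rewrite Cmod_1, Cmod_opp, Cmod_mult, Cmod_pow. lra.
      * apply Rinv_le_contravar; [exact Hd|].
        rewrite <- Cmod_pow.
        (* Reverse triangle inequality, from $1 = (1 - q^{n+1}) + q^{n+1}$. *)
        pose proof (Cmod_triangle (1 - q ^ S n) (q ^ S n)) as T.
        replace (1 - q ^ S n + q ^ S n) with (RtoC 1) in T by ring.
        rewrite Cmod_1 in T. lra.
Qed.

(** Ratio test: successive quotients tend to 1 because $|q|^n \to 0$. *)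
Lemma CV_radius_qbin_bound : CV_radius qbin_bound = 1%R.
Proof.
  rewrite (CV_radius_finite_DAlembert _ 1), Rinv_1; [reflexivity | | lra |].
  - intros n. apply Rgt_not_eq, qbin_bound_pos.
  - assert (Hp : is_lim_seq (fun n => Cmod q ^ n)%R 0%R).
    { apply is_lim_seq_geom. rewrite Rabs_pos_eq; apply Cmod_q_bounds. }
    apply is_lim_seq_ext with
      (fun n => (1 + Cmod a * Cmod q ^ n) / (1 - Cmod q ^ S n))%R.
    { intros n. pose proof (qbin_bound_pos n) as Hb.
      replace (qbin_bound (S n) / qbin_bound n)%R
        with ((1 + Cmod a * Cmod q ^ n) / (1 - Cmod q ^ S n))%R.
      - symmetry. apply Rabs_pos_eq, Rlt_le, qbin_bound_ratio_pos.
      - change (qbin_bound (S n)) with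
          (qbin_bound n * ((1 + Cmod a * Cmod q ^ n) / (1 - Cmod q ^ S n)))%R.
        unfold Rdiv. rewrite (Rmult_comm (qbin_bound n)), Rmult_assoc, Rinv_r; lra. }
    replace (Finite 1) with (Finite ((1 + Cmod a * 0) / (1 - 0)))
      by (f_equal; field).
    apply is_lim_seq_div'; [| |lra].
    + apply is_lim_seq_plus'; [apply is_lim_seq_const|].
      apply is_lim_seq_mult'; [apply is_lim_seq_const | exact Hp].
    + apply is_lim_seq_minus'; [apply is_lim_seq_const|].
      apply (is_lim_seq_incr_1 (fun n => Cmod q ^ n)%R). exact Hp.
Qed.

(** * The sum on the unit disk and its functional equation *)

(** The function $F$. Using [lim] makes it total in [w]; [is_series_qbin_sum] gives it its meaning
    on the open unit disk. *)
Definition qbin_sum (w : C) : C :=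
  @lim C_CompleteNormedModule
    (filtermap (@sum_n C_NormedModule (fun n => qbin n * w ^ n)) eventually).

Section disk.

Variable w : C.
Hypothesis hw : (Cmod w < 1)%R.

Lemma ex_series_Cmod_qbin : ex_series (fun n => Cmod (qbin n * w ^ n)).
Proof.
  apply (@ex_series_le _ R_CompleteNormedModule _
           (fun n => Rabs (qbin_bound n * Cmod w ^ n))).
  - intros n.
    change (Rabs (Cmod (qbin n * w ^ n)) <= Rabs (qbin_bound n * Cmod w ^ n))%R.
    rewrite Cmod_mult, Cmod_pow, !Rabs_mult.
    apply Rmult_le_compat_r; [apply Rabs_pos|].
    rewrite !Rabs_pos_eq; [apply qbin_le_bound | | apply Cmod_ge_0].
    apply Rlt_le, qbin_bound_pos.
  - apply CV_disk_inside. rewrite CV_radius_qbin_bound.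
    simpl. rewrite Rabs_pos_eq; [exact hw | apply Cmod_ge_0].
Qed.

Lemma is_series_qbin_sum :
  @is_series C_AbsRing C_NormedModule (fun n => qbin n * w ^ n) (qbin_sum w).
Proof.
  destruct (@ex_series_le C_AbsRing C_CompleteNormedModule
              (fun n => qbin n * w ^ n) _ (fun n => Rle_refl _)
              ex_series_Cmod_qbin) as [l Hl].
  replace (qbin_sum w) with l; [exact Hl|].
  symmetry. apply lim_C_eq. exact Hl.
Qed.

End disk.

Lemma Cmod_mult_qpow_lt_1 (w : C) (n : nat) :
  (Cmod w < 1)%R -> (Cmod (w * q ^ n) < 1)%R.
Proof.
  intros hw. rewrite Cmod_mult, Cmod_pow.
  apply Rle_lt_trans with (Cmod w * 1)%R; [|lra].
  apply Rmult_le_compat_l; [apply Cmod_ge_0|].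
  rewrite <- (pow1 n). apply pow_incr.
  split; [apply Cmod_ge_0 | apply Rlt_le, hq].
Qed.

Lemma qbin_sum_functional_eq (w : C) : (Cmod w < 1)%R ->
  (1 - w) * qbin_sum w = (1 - a * w) * qbin_sum (w * q).
Proof.
  intros hw.
  set (l := qbin_sum w). set (l' := qbin_sum (w * q)).
  assert (Hl := is_series_qbin_sum w hw). fold l in Hl.
  assert (Hl' : @is_series C_AbsRing C_NormedModule
                  (fun n => qbin n * (w * q) ^ n) l').
  { apply is_series_qbin_sum. rewrite <- (Cpow_1_r q).
    apply Cmod_mult_qpow_lt_1, hw. }
  (* With $c_n$ for [qbin n], both sides are the sum of $c_n w^{n+1} (1 - a q^n)$: the left one by
     $(1 - q^{n+1}) c_{n+1} = (1 - a q^n) c_n$, the right one by expanding. *)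
  assert (E : l - l' = w * (l - a * l')).
  { apply (filterlim_C_unique
             (@sum_n C_NormedModule (fun n => qbin n * w ^ S n * (1 - a * q ^ n)))).
    - apply (is_series_C_ext
               (fun n => qbin (S n) * w ^ S n - qbin (S n) * (w * q) ^ S n)).
      { intros n. rewrite qbin_S, Cpow_mult_l. field.
        apply one_minus_qpow_neq_0. }
      apply (@is_series_incr_1 C_AbsRing C_NormedModule
               (fun n => qbin n * w ^ n - qbin n * (w * q) ^ n)).
      (* The terms of index 0 cancel, so the shift of index leaves the sum unchanged. *)
      replace (@plus C_NormedModule (l - l') _) with (l - l')
        by (change (l - l' = l - l' + (qbin 0 * 1 - qbin 0 * 1)); ring).
      exact (@is_series_minus C_AbsRing C_NormedModule _ _ _ _ Hl Hl').
    - apply (is_series_C_ext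
               (fun n => w * (qbin n * w ^ n - a * (qbin n * (w * q) ^ n)))).
      { intros n. rewrite Cpow_mult_l, Cpow_S. ring. }
      apply (@is_series_scal C_AbsRing C_NormedModule w).
      apply (@is_series_minus C_AbsRing C_NormedModule _ _ _ _ Hl).
      exact (@is_series_scal C_AbsRing C_NormedModule a _ _ Hl'). }
  transitivity (l - l' + l' - w * l); [ring|].
  rewrite E. ring.
Qed.

(** * Iterating the functional equation *)

Variable z : C.
Hypothesis hz : (Cmod z < 1)%R.

Lemma qpoch_mult_qbin_sum (n : nat) :
  qpoch z q n * qbin_sum z = qpoch (a * z) q n * qbin_sum (z * q ^ n).
Proof.
  induction n as [|n IH].
  - simpl. rewrite !Cmult_1_l, Cmult_1_r. reflexivity.
  - pose proof (qbin_sum_functional_eq _ (Cmod_mult_qpow_lt_1 z n hz)) as E.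
    replace (z * q ^ S n) with (z * q ^ n * q) by (rewrite Cpow_S; ring).
    simpl.
    transitivity ((1 - z * q ^ n) * (qpoch z q n * qbin_sum z)); [ring|].
    rewrite IH.
    transitivity (qpoch (a * z) q n * ((1 - z * q ^ n) * qbin_sum (z * q ^ n)));
      [ring|].
    rewrite E. ring.
Qed.

(** For $k \ge 1$ the $k$-th term at $z q^n$ is at most $|q|^n$ times the modulus of the $k$-th term
    at $z$. Hence $|F(z q^n) - 1| \le |q|^n s$, where $s$ is the sum of those moduli over $k \ge
    1$. *)
Lemma qbin_sum_lim :
  filterlim (fun n => qbin_sum (z * q ^ n)) eventually
    (@locally C_UniformSpace (RtoC 1)).
Proof.
  apply filterlim_C_Cmod.
  destruct (proj1 (ex_series_incr_1 _) (ex_series_Cmod_qbin z hz)) as [s Hs].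
  apply is_lim_seq_le_le with (fun _ => 0%R) (fun n => (Cmod q ^ n * s)%R).
  - intros n. split; [apply Cmod_ge_0|].
    apply is_series_C_Cmod_le with
      (fun k => qbin (S k) * (z * q ^ n) ^ S k)
      (fun k => (Cmod q ^ n * Cmod (qbin (S k) * z ^ S k))%R).
    + intros k.
      rewrite Cpow_mult_l, Cmult_assoc, Cmod_mult, Rmult_comm.
      apply Rmult_le_compat_r; [apply Cmod_ge_0|].
      (* Split $|q|^{n(k+1)} = |q|^n |q|^{nk}$ and bound the last factor by 1. *)
      rewrite <- Cpow_mult_r, Cmod_pow, Nat.mul_succ_r, Nat.add_comm, pow_add.
      rewrite <- (Rmult_1_r (Cmod q ^ n)) at 2.
      apply Rmult_le_compat_l; [apply pow_le, Cmod_ge_0|].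
      rewrite <- (pow1 (n * k)). apply pow_incr.
      split; [apply Cmod_ge_0 | apply Rlt_le, hq].
    + apply (@is_series_incr_1 C_AbsRing C_NormedModule
               (fun k => qbin k * (z * q ^ n) ^ k)).
      replace (@plus C_NormedModule _ _) with (qbin_sum (z * q ^ n)).
      * apply is_series_qbin_sum, Cmod_mult_qpow_lt_1, hz.
      * change (qbin_sum (z * q ^ n) = qbin_sum (z * q ^ n) - 1 + 1 / 1 * 1).
        field.
    + exact (@is_series_scal R_AbsRing R_NormedModule (Cmod q ^ n)%R _ _ Hs).
  - apply is_lim_seq_const.
  - replace (Finite 0) with (Finite (0 * s)) by (f_equal; ring).
    apply is_lim_seq_mult'; [|apply is_lim_seq_const].
    apply is_lim_seq_geom. rewrite Rabs_pos_eq; apply Cmod_q_bounds.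
Qed.

End qbinomial.

(** * Convergence of the infinite products *)

Lemma qpoch_lim_disk (z q : C) : (Cmod z < 1)%R -> (Cmod q < 1)%R ->
  exists l : C, l <> 0 /\
    filterlim (qpoch z q) eventually (@locally C_UniformSpace l).
Proof.
  intros hz hq.
  set (G := qbin_sum 0 q z).
  assert (E : forall n, qbin_sum 0 q (z * q ^ n) = qpoch z q n * G).
  { intros n. unfold G. rewrite (qpoch_mult_qbin_sum 0 q hq z hz).
    rewrite Cmult_0_l, qpoch_0_l. ring. }
  assert (H := qbin_sum_lim 0 q hq z hz).
  (* If [G] were 0, [E] would make a sequence with limit 1 identically 0. *)
  assert (HG : G <> 0).
  { intros G0. apply C1_nz.
    apply (filterlim_C_unique (fun n => qbin_sum 0 q (z * q ^ n))); [exact H|].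
    apply filterlim_ext with (fun _ : nat => RtoC 0).
    - intros n. rewrite E, G0. ring.
    - apply filterlim_const. }
  exists (1 * / G). split.
  - intros E0. apply C1_nz.
    transitivity (G * (1 * / G)); [field; exact HG | rewrite E0; ring].
  - apply filterlim_ext with (fun n => qbin_sum 0 q (z * q ^ n) * / G).
    + intros n. rewrite E. field. exact HG.
    + apply filterlim_C_mult; [exact H | apply filterlim_const].
Qed.

(** Some $x q^m$ lies in the unit disk, so the product splits into its first $m$ factors and a
    convergent tail. Those factors may vanish, so the limit may be 0. This serves $x = az$, whose
    modulus is arbitrary. *)
Lemma qpoch_lim (x q : C) : (Cmod q < 1)%R ->
  exists l : C, filterlim (qpoch x q) eventually (@locally C_UniformSpace l).
Proof.
  intros hq.
  assert (Hm : exists m, (Cmod (x * q ^ m) < 1)%R).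
  { assert (H : is_lim_seq (fun n => Cmod x * Cmod q ^ n)%R (Cmod x * 0)%R).
    { apply is_lim_seq_mult'; [apply is_lim_seq_const|].
      apply is_lim_seq_geom. rewrite Rabs_pos_eq; [exact hq | apply Cmod_ge_0]. }
    rewrite Rmult_0_r in H. apply is_lim_seq_spec in H.
    destruct (H (mkposreal 1 Rlt_0_1)) as [m Hm]. exists m.
    specialize (Hm m (Nat.le_refl m)). simpl in Hm.
    rewrite Cmod_mult, Cmod_pow. apply Rabs_def2 in Hm. lra. }
  destruct Hm as [m Hm].
  destruct (qpoch_lim_disk _ q Hm hq) as [l [_ Hl]].
  exists (qpoch x q m * l).
  assert (H : filterlim (fun n => qpoch x q (n + m)) eventually
                (@locally C_UniformSpace (qpoch x q m * l))).
  { apply filterlim_ext with (fun n => qpoch x q m * qpoch (x * q ^ m) q n).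
    - intros n. rewrite Nat.add_comm. symmetry. apply qpoch_add.
    - apply filterlim_C_mult; [apply filterlim_const | exact Hl]. }
  (* Undo the shift of the index by [m]. *)
  intros P HP. destruct (H P HP) as [N HN]. exists (N + m)%nat. intros n Hn.
  replace n with (n - m + m)%nat by lia. apply HN. lia.
Qed.

(** Division and [lim] are total, so the first four conjuncts are what gives the quotients and
    infinite products of the last one their intended meaning. *)
Theorem theorem1 (a z q : C) (hz : (Cmod z < 1)%R) (hq : (Cmod q < 1)%R) :
  (forall n : nat, qpoch q q n <> 0) /\
  qpoch_inf_cvg (a * z) q /\
  qpoch_inf_cvg z q /\
  qpoch_inf z q <> 0 /\
  @is_series C_AbsRing C_NormedModule
    (fun n : nat => qpoch a q n * z ^ n / qpoch q q n)
    (qpoch_inf (a * z) q / qpoch_inf z q).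
Proof.
  destruct (qpoch_lim (a * z) q hq) as [m Hm].
  destruct (qpoch_lim_disk z q hz hq) as [l [l_neq_0 Hl]].
  destruct (qpoch_inf_eq _ _ _ Hm) as [Cm Em].
  destruct (qpoch_inf_eq _ _ _ Hl) as [Cl El].
  split; [exact (qpoch_q_neq_0 q hq)|].
  split; [exact Cm|]. split; [exact Cl|].
  rewrite Em, El. split; [exact l_neq_0|].
  (* Let $n \to \infty$ in [qpoch_mult_qbin_sum]; the factor 1 is the limit of $F(z q^n)$. *)
  assert (E : l * qbin_sum a q z = m * 1).
  { apply (filterlim_C_unique (fun n => qpoch z q n * qbin_sum a q z)).
    - apply filterlim_C_mult; [exact Hl | apply filterlim_const].
    - apply filterlim_ext with
        (fun n => qpoch (a * z) q n * qbin_sum a q (z * q ^ n)).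
      + intros n. symmetry. apply qpoch_mult_qbin_sum; assumption.
      + apply filterlim_C_mult; [exact Hm | apply qbin_sum_lim; assumption]. }
  replace (m / l) with (qbin_sum a q z).
  - apply (is_series_C_ext (fun n => qbin a q n * z ^ n)).
    + intros n. unfold qbin. field. apply qpoch_q_neq_0, hq.
    + apply is_series_qbin_sum; assumption.
  - rewrite Cmult_1_r in E. rewrite <- E. field. exact l_neq_0.
Qed.
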